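(* Let $\Omega$ be a nonempty set with a flow $\theta=\{\theta_t\}_{t\in\mathbb{R}}$, let $(\mathcal{G},d_{\mathcal{G}})$ be a nonempty complete metric space with bounded metric, and let $\Phi$ be a cocycle on $\mathcal{G}$ over $\theta$; in particular $\Phi(t,\omega,\mathcal{G})\subset\mathcal{G}$ for all $\omega\in\Omega$, $t\ge 0$. Suppose that $x\mapsto\Phi(t,\omega,x)$ is continuous for all $t\ge 0$, $\omega\in\Omega$, and that there exists a constant $k<0$ such that for every $\omega\in\Omega$ $$\sup_{x\neq y\in\mathcal{G}}\log\frac{d_{\mathcal{G}}(\Phi(1,\omega,x),\Phi(1,\omega,y))}{d_{\mathcal{G}}(x,y)}\le k .$$ Then $\Phi$ has a unique generalized fixed point $\gamma^\ast$ in $\mathcal{G}$. Moreover, $$\lim_{t\to\infty}\Phi(t,\theta_{-t}\omega,x)=\gamma^\ast(\omega)$$ for every $\omega\in\Omega$ and every $x\in\mathcal{G}$.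
   Context: A flow on $\Omega$ is a family of maps $\theta_t:\Omega\to\Omega$, $t\in\mathbb{R}$, with $\theta_0=\mathrm{id}_\Omega$ and $\theta_{t_1}\circ\theta_{t_2}=\theta_{t_1+t_2}$ for $t_1,t_2\in\mathbb{R}$. No measurability is required here. A cocycle on $\mathcal{G}$ over $\theta$ is a map $\Phi:\mathbb{R}^+\times\Omega\times\mathcal{G}\to\mathcal{G}$ ($\mathbb{R}^+=[0,\infty)$) with $\Phi(0,\omega,x)=x$ and $\Phi(t_1+t_2,\omega,x)=\Phi(t_2,\theta_{t_1}\omega,\Phi(t_1,\omega,x))$ for $t_1,t_2\ge 0$, $\omega\in\Omega$, $x\in\mathcal{G}$. A generalized fixed point of $\Phi$ is a map $\gamma^\ast:\Omega\to\mathcal{G}$ with $\Phi(t,\omega,\gamma^\ast(\omega))=\gamma^\ast(\theta_t\omega)$ for all $t\ge 0$, $\omega\in\Omega$. Convention: $\log 0=-\infty$. *)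

(* Defs.v *)
From HB Require Import structures.
From mathcomp Require Import all_boot all_order all_algebra.
From mathcomp Require Import all_classical all_reals all_analysis.

Set Implicit Arguments.
Unset Strict Implicit.
Unset Printing Implicit Defensive.

Import Order.TTheory GRing.Theory Num.Theory.
Import numFieldNormedType.Exports.

Local Open Scope classical_set_scope.
Local Open Scope ring_scope.

(* [Complete] spaces are pointed, so a [completeMetricType] is nonempty. *)
#[short(type="completeMetricType")]
HB.structure Definition CompleteMetric (K : numDomainType) :=
  { M of Metric K M & Complete M }.

Definition bounded_metric (R : realType) (G : metricType R) : Prop :=
  exists M : R, forall x y : G, mdist x y <= M.

Definition is_flow (R : realType) (Omega : Type)
    (theta : R -> Omega -> Omega) : Prop :=
  theta 0 = id /\
  forall t1 t2 : R, theta t1 \o theta t2 = theta (t1 + t2).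

(* The time set of a cocycle is [0, +oo[: here time ranges over the whole of R,
   and the values at negative times are never constrained nor used. *)
Definition is_cocycle (R : realType) (Omega G : Type)
    (theta : R -> Omega -> Omega) (Phi : R -> Omega -> G -> G) : Prop :=
  (forall w x, Phi 0 w x = x) /\
  (forall t1 t2 : R, 0 <= t1 -> 0 <= t2 -> forall w x,
     Phi (t1 + t2) w x = Phi t2 (theta t1 w) (Phi t1 w x)).

Definition generalized_fixed_point (R : realType) (Omega G : Type)
    (theta : R -> Omega -> Omega) (Phi : R -> Omega -> G -> G)
    (gamma : Omega -> G) : Prop :=
  forall t : R, 0 <= t -> forall w, Phi t w (gamma w) = gamma (theta t w).

(* [lne] sends 0 to -oo, and the supremum is -oo if G has a single point. *)
Definition sup_log_ratio (R : realType) (G : metricType R) (f : G -> G)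
    : \bar R :=
  ereal_sup [set lne (mdist (f xy.1) (f xy.2) / mdist xy.1 xy.2)%:E
            | xy in [set xy : G * G | xy.1 <> xy.2]].

(* Main.v *)
Require Import Defs.
From HB Require Import structures.
From mathcomp Require Import all_boot all_order all_algebra.
From mathcomp Require Import all_classical all_reals all_analysis.
Import Order.TTheory GRing.Theory Num.Theory.
Import numFieldNormedType.Exports.
Local Open Scope classical_set_scope.
Local Open Scope ring_scope.

(** Follow the cocycle up to the present from ever more remote pasts: at time
    [t] the pullback of [x] to the fibre of [w] is
    [Phi t (theta (- t) w) x].  The map [Phi 1 w] is a [q]-contraction with
    [q = expR k < 1], uniformly in [w], hence [Phi n w] is a
    [q ^+ n]-contraction.  As soon as [n <= t], the cocycle property writes the
    pullback at time [t] as the image under the one map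
    [Phi n (theta (- n) w)] of some point of [G]; that map shrinks the whole
    bounded space to a set of diameter at most [q ^+ n * M].  Any two pullbacks
    at times past [n], from any two starting points, are therefore within
    [q ^+ n * M] of each other ([pullback_close]).

    Everything follows from this estimate.  Pullbacks are Cauchy in time, so
    they converge to a point [gamma w] that does not depend on the starting
    point ([cvg_pullback]).  Pushing the limit forward by the continuous map
    [Phi s w] only shifts the pullback time by [s], so [gamma] is a generalized
    fixed point ([pullback_limit_fixed]).  A generalized fixed point passes at
    every time through a pullback, so pullbacks converge to it
    ([cvg_pullback_fixed_point]): it is unique. *)

(** The bound on the logarithms covers the pairs with [f x = f y], where the
    logarithm is [-oo], and says nothing of the pairs with [x = y], where the
    conclusion is trivial. *)
Lemma contraction_of_sup_log_ratio (R : realType) (G : metricType R)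
    (f : G -> G) (k : R) (x y : G) :
  (sup_log_ratio f <= k%:E)%E -> mdist (f x) (f y) <= expR k * mdist x y.
Proof.
move=> supk; have [->|xy] := pselect (x = y).
  by rewrite !mdistxx mulr0.
have d0 : 0 < mdist x y by rewrite mdist_gt0; exact/eqP.
rewrite -ler_pdivrMr//.
have : (lne (mdist (f x) (f y) / mdist x y)%:E <= k%:E)%E.
  by apply: le_trans supk; apply: ereal_sup_ubound; exists (x, y).
set r := _ / _; have [r0 _|r0] := leP r 0.
  by rewrite (le_trans r0)// expR_ge0.
by rewrite lne_EFin// lee_fin -ler_expR lnK.
Qed.

Section PullbackContraction.
Context {R : realType} {Omega : Type} {theta : R -> Omega -> Omega}.
Context {G : completeMetricType R} {Phi : R -> Omega -> G -> G} {M q : R}.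
Hypothesis theta_flow : is_flow theta.
Hypothesis Phi_cocycle : is_cocycle theta Phi.
Hypothesis Phi_continuous : forall t w, 0 <= t -> continuous (Phi t w).
Hypothesis G_bounded : forall x y : G, mdist x y <= M.
Hypotheses (q_ge0 : 0 <= q) (q_lt1 : q < 1).
Hypothesis Phi1_contracting :
  forall w x y, mdist (Phi 1 w x) (Phi 1 w y) <= q * mdist x y.

Definition pullback (w : Omega) (x : G) (t : R) : G := Phi t (theta (- t) w) x.

Lemma flowD s t w : theta s (theta t w) = theta (s + t) w.
Proof. by case: theta_flow => _ <-. Qed.

Lemma Phi_nat_contracting n w x y :
  mdist (Phi n%:R w x) (Phi n%:R w y) <= q ^+ n * mdist x y.
Proof.
have [Phi0 PhiD] := Phi_cocycle.
elim: n w x y => [|n IHn] w x y; first by rewrite !Phi0 expr0 mul1r.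
rewrite -natr1 !PhiD//; apply: le_trans (Phi1_contracting _ _ _) _.
by rewrite exprS -mulrA ler_wpM2l.
Qed.

(** Only the last [s] units of time matter for the contraction: what happened
    before merely selects a point of [G]. *)
Lemma pullback_factor s t w x : 0 <= s -> s <= t ->
  pullback w x t = Phi s (theta (- s) w) (Phi (t - s) (theta (- t) w) x).
Proof.
have [_ PhiD] := Phi_cocycle => s0 st.
have -> : theta (- s) w = theta (t - s) (theta (- t) w).
  by rewrite flowD; congr theta; rewrite addrAC subrr sub0r.
by rewrite -PhiD ?subr_ge0// subrK.
Qed.

(** One threshold serves all fibres and all starting points, because neither
    the contraction rate nor the diameter depends on them. *)
Lemma pullback_close (eps : R) : 0 < eps ->
  exists N : R, forall w x y s t, N <= s -> N <= t ->
    mdist (pullback w x s) (pullback w y t) < eps.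
Proof.
move=> eps0; have q1 : `|q| < 1 by rewrite ger0_norm.
have /cvgrPdist_lt/(_ _ eps0) := @cvg_geometric R M q q1.
case=> n _ /(_ n (leqnn n)); rewrite /= /geometric sub0r normrN => qnM.
exists n%:R => w x y s t ns nt; rewrite !(pullback_factor n%:R)//.
apply: le_lt_trans (Phi_nat_contracting _ _ _ _) _.
apply: le_lt_trans (le_lt_trans (ler_norm _) qnM).
by rewrite mulrC ler_wpM2r// exprn_ge0.
Qed.

(** Two pullbacks at late times are close whatever their starting points, so
    the Cauchy property and the independence of [x] come from one estimate. *)
Lemma cvg_pullback w x :
  pullback w x t @[t --> +oo] --> lim (pullback w point t @[t --> +oo]).
Proof.
have cvg_point : cvg (pullback w point t @[t --> +oo]).
  apply/cauchy_cvgP/cauchyP => eps /pullback_close[N close].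
  exists (pullback w point N).
  suff : \forall t \near +oo, ball (pullback w point N) eps (pullback w point t)
    by [].
  near=> t; rewrite ballEmdist/=.
  by apply: close => //; near: t; exact: (nbhs_pinfty_ge (num_real _)).
apply/metricType_numDomainType.cvgrPdist_lt => eps eps0.
have e2 : 0 < eps / 2 by rewrite divr_gt0.
have [N close] := pullback_close _ e2; near=> t.
apply: le_lt_trans (metric_triangle _ (pullback w point t) _) _.
rewrite [ltRHS]splitr; apply: ltrD.
  by near: t; exact: (metricType_numDomainType.cvgr_dist_lt cvg_point).
have Nt : N <= t by near: t; exact: (nbhs_pinfty_ge (num_real _)).
exact: close.
Unshelve. all: by end_near. Qed.

Lemma pullback_limit_fixed :
  generalized_fixed_point theta Phi
    (fun w => lim (pullback w point t @[t --> +oo])).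
Proof.
have [_ PhiD] := Phi_cocycle => s s0 w.
apply: (@cvg_unique _ (@metric_hausdorff R G)
  (pullback (theta s w) point (t + s) @[t --> +oo])).
  have Phi_lim :
      (Phi s w \o pullback w point) @ +oo -->
      Phi s w (lim (pullback w point @ +oo)).
    by apply: cvg_comp (cvg_pullback w point) _; exact: Phi_continuous.
  apply: cvg_trans Phi_lim; apply: near_eq_cvg; near=> t.
  have t0 : 0 <= t by near: t; exact: (nbhs_pinfty_ge (num_real _)).
  have same_past : theta (- (t + s)) (theta s w) = theta (- t) w.
    by rewrite flowD opprD addrNK.
  have present : theta t (theta (- t) w) = w.
    by rewrite flowD subrr (proj1 theta_flow).
  by rewrite /pullback/= same_past PhiD// present.
by apply: cvg_comp (cvg_addrr s) _; exact: cvg_pullback.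
Unshelve. all: by end_near. Qed.

(** The value of [gamma] at [w] is itself the pullback of a point that varies
    with [t], which the uniformity of [pullback_close] tolerates. *)
Lemma cvg_pullback_fixed_point gamma w x :
  generalized_fixed_point theta Phi gamma ->
  pullback w x t @[t --> +oo] --> gamma w.
Proof.
move=> gamma_fixed.
apply/metricType_numDomainType.cvgrPdist_lt => eps /pullback_close[N close].
near=> t; have t0 : 0 <= t by near: t; exact: (nbhs_pinfty_ge (num_real _)).
have Nt : N <= t by near: t; exact: (nbhs_pinfty_ge (num_real _)).
have -> : gamma w = pullback w (gamma (theta (- t) w)) t.
  by rewrite /pullback gamma_fixed// flowD subrr (proj1 theta_flow).
exact: close.
Unshelve. all: by end_near. Qed.

End PullbackContraction.

Arguments pullback {R Omega} theta {G} Phi w x t.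

Theorem theorem4p1 (R : realType) (Omega : Type) (Omega_nonempty : inhabited Omega)
    (theta : R -> Omega -> Omega) (theta_flow : is_flow theta)
    (G : completeMetricType R) (G_bounded : bounded_metric G)
    (Phi : R -> Omega -> G -> G) (Phi_cocycle : is_cocycle theta Phi)
    (Phi_continuous :
       forall (t : R) (w : Omega), 0 <= t -> continuous (Phi t w))
    (Phi_contracting : exists2 k : R, k < 0 &
       forall w : Omega, (sup_log_ratio (Phi 1%R w) <= k%:E)%E) :
  exists gamma : Omega -> G,
    unique (generalized_fixed_point theta Phi) gamma /\
    forall (w : Omega) (x : G),
      Phi t (theta (- t) w) x @[t --> +oo] --> gamma w.
Proof.
have [M G_le_M] := G_bounded; have [k k_lt0 supk] := Phi_contracting.
have q1 : expR k < 1 by rewrite expR_lt1.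
have q0 : 0 <= expR k by exact: expR_ge0.
have contr w x y : mdist (Phi 1 w x) (Phi 1 w y) <= expR k * mdist x y.
  exact: contraction_of_sup_log_ratio.
exists (fun w => lim (pullback theta Phi w point t @[t --> +oo])).
split=> [|w x]; last exact: (cvg_pullback theta_flow Phi_cocycle G_le_M q0 q1 contr).
split=> [|gamma gamma_fixed].
  exact: (pullback_limit_fixed theta_flow Phi_cocycle Phi_continuous G_le_M q0 q1 contr).
apply/funext => w; apply/(cvg_lim (@metric_hausdorff R G)).
exact: (cvg_pullback_fixed_point theta_flow Phi_cocycle G_le_M q0 q1 contr).
Qed.
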